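(* Let $(N,M,\boldsymbol q)$ be a setting, $\varphi$ and $\psi$ mechanisms, $\boldsymbol P\in\mathcal P^N$ a preference profile, $\beta\in[0,1]$, and $h^\beta=(1-\beta)\varphi+\beta\psi$. Then: 1. if $\varphi(\boldsymbol P)$ and $\psi(\boldsymbol P)$ are ex-post efficient at $\boldsymbol P$, then $h^\beta(\boldsymbol P)$ is ex-post efficient at $\boldsymbol P$; 2. $\psi(\boldsymbol P)$ ordinally dominates $\varphi(\boldsymbol P)$ at $\boldsymbol P$ if and only if both $h^\beta(\boldsymbol P)$ ordinally dominates $\varphi(\boldsymbol P)$ at $\boldsymbol P$ and $\psi(\boldsymbol P)$ ordinally dominates $h^\beta(\boldsymbol P)$ at $\boldsymbol P$; and the same equivalence holds with ''ordinally dominates'' replaced by ''rank dominates'' throughout.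
   Context: A setting $(N,M,\boldsymbol q)$ consists of a finite set $N$ of $n$ agents, a finite set $M$ of $m$ objects, and a vector $\boldsymbol q=(q_j)_{j\in M}$ of capacities (positive integers) with $n\le\sum_{j\in M}q_j$. $\mathcal P$ is the set of strict preference orders (linear orders) over $M$; $P:a\succ b$ means $a$ is strictly preferred to $b$ under $P$. A preference profile is $\boldsymbol P=(P_i)_{i\in N}\in\mathcal P^N$. An assignment is an $N\times M$ matrix $x$ with $x_{i,j}\in[0,1]$, $\sum_{j}x_{i,j}=1$ for all $i$, and $\sum_i x_{i,j}\le q_j$ for all $j$; it is deterministic if all $x_{i,j}\in\{0,1\}$. A mechanism is a map from $\mathcal P^N$ to the set $\Delta(X)$ of assignments; hybrids are pointwise convex combinations. Ex-post efficiency: a deterministic assignment $x$ ex-post dominates a deterministic assignment $y$ at $\boldsymbol P$ if every agent weakly prefers (under its order in $\boldsymbol P$) its object under $x$ to its object under $y$; strictly, if in addition some agent strictly prefers its object under $x$. A deterministic assignment is ex-post efficient at $\boldsymbol P$ if it is not strictly ex-post dominated by any deterministic assignment at $\boldsymbol P$. A (random) assignment is ex-post efficient at $\boldsymbol P$ if it can be written as a convex combination (lottery) of deterministic assignments that are ex-post efficient at $\boldsymbol P$. Ordinal dominance: for $P:a_1\succ\dots\succ a_m$, an assignment vector $v=(v_j)_{j\in M}$ first order-stochastically dominates $w$ at $P$ if $\sum_{j\in M:\,P:j\succ a_k}v_j\ge\sum_{j\in M:\,P:j\succ a_k}w_j$ for all $k\in\{1,\dots,m\}$. An assignment $x$ ordinally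 dominates $y$ at $\boldsymbol P$ if for all $i\in N$ the row $x_i$ first order-stochastically dominates $y_i$ at $P_i$. Rank dominance: let $\mathrm{ch}_{P_i}(k)$ be the $k$th most preferred object under $P_i$. The rank distribution of $x$ at $\boldsymbol P$ is $(d^x_1,\dots,d^x_m)$ with $d^x_k=\sum_{i\in N}x_{i,\mathrm{ch}_{P_i}(k)}$. $x$ rank dominates $y$ at $\boldsymbol P$ if $\sum_{k=1}^{r}(d^x_k-d^y_k)\ge0$ for all $r\in\{1,\dots,m\}$. *)

(* Defs.v *)
From HB Require Import structures.
From mathcomp Require Import all_boot all_order all_algebra.
Set Implicit Arguments.
Unset Strict Implicit.
Unset Printing Implicit Defensive.
Import Order.TTheory GRing.Theory Num.Theory.
Local Open Scope ring_scope.

(* Real numbers are represented by an arbitrary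
   [R : realFieldType]: only ordered-field operations are involved. *)

Record setting := Setting {
  agent : finType;
  object : finType;
  capacity : object -> nat;
  capacity_gt0 : forall j : object, (0 < capacity j)%N;
  enough_capacity : (#|agent| <= \sum_(j : object) capacity j)%N }.

Section Preferences.
Variable M : finType.

Definition strict_linear_order (r : {set M * M}) : bool :=
  [&& [forall a, (a, a) \notin r],
      [forall a, forall b, forall c,
         ((a, b) \in r) && ((b, c) \in r) ==> ((a, c) \in r)]
    & [forall a, forall b, (a != b) ==> ((a, b) \in r) || ((b, a) \in r)]].

(* An order is its graph, so that Leibniz equality of preference orders (and
   hence of preference profiles) is extensional equality. *)
Record pref := Pref {
  pref_set : {set M * M};
  _ : strict_linear_order pref_set }.

HB.instance Definition _ := [isSub for pref_set].
HB.instance Definition _ := [Finite of pref by <:].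

Definition prefers (P : pref) (a b : M) : bool := (a, b) \in pref_set P.

Definition weakly_prefers (P : pref) (a b : M) : bool :=
  (a == b) || prefers P a b.

(* The objects sorted from best to worst. Indices start at 0, so that
   [choice_at P k] is the (k+1)-st most preferred object; the default value
   [enum_val k] is never used, since [k < #|M|]. *)
Definition choice_at (P : pref) (k : 'I_#|M|) : M :=
  nth (enum_val k) (sort (weakly_prefers P) (enum M)) k.

End Preferences.

Definition profile (S : setting) := {ffun agent S -> pref (object S)}.

Section Assignments.
Variables (R : realFieldType) (S : setting).
Local Notation N := (agent S).
Local Notation M := (object S).

Definition is_assignment (x : {ffun N -> {ffun M -> R}}) : bool :=
  [&& [forall i, forall j, 0 <= x i j <= 1],
      [forall i, \sum_j x i j == 1]
    & [forall j, \sum_i x i j <= (capacity j)%:R]].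

Record assignment := Assignment {
  assignment_mx :> {ffun N -> {ffun M -> R}};
  assignmentP : is_assignment assignment_mx }.

Definition mechanism := profile S -> assignment.

Definition conv_mx (b : R) (x y : {ffun N -> {ffun M -> R}}) :
    {ffun N -> {ffun M -> R}} :=
  [ffun i => [ffun j => (1 - b) * x i j + b * y i j]].

Lemma conv_is_assignment (b : R) (x y : assignment) :
  0 <= b <= 1 -> is_assignment (conv_mx b x y).
Proof.
move=> /andP[b0 b1]; have c0 : 0 <= 1 - b by rewrite subr_ge0.
have cb (t : R) : (1 - b) * t + b * t = t by rewrite -mulrDl subrK mul1r.
case: x => x /= /and3P[/forallP xb /forallP xr /forallP xc].
case: y => y /= /and3P[/forallP yb /forallP yr /forallP yc].
apply/and3P; split; apply/forallP => i.
- apply/forallP => j; rewrite !ffunE.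
  move/forallP: (xb i) => /(_ j)/andP[x0 x1].
  move/forallP: (yb i) => /(_ j)/andP[y0 y1].
  apply/andP; split; first by rewrite addr_ge0 ?mulr_ge0.
  by rewrite -[leRHS](cb 1) lerD ?ler_wpM2l.
- under eq_bigr do rewrite !ffunE.
  by rewrite big_split /= -!mulr_sumr (eqP (xr i)) (eqP (yr i)) cb.
- under eq_bigr do rewrite !ffunE.
  rewrite big_split /= -!mulr_sumr -[leRHS]cb.
  by rewrite lerD ?ler_wpM2l.
Qed.

Definition hybrid (b : R) (hb : 0 <= b <= 1) (phi psi : mechanism) :
    mechanism :=
  fun P => Assignment (conv_is_assignment (phi P) (psi P) hb).

Definition deterministic (x : assignment) : Prop :=
  forall i j, x i j = 0 \/ x i j = 1.

(* For deterministic [x], agent [i]'s object is the unique [a] with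
   [x i a = 1]; the relations below are only used between deterministic
   assignments. *)
Definition ex_post_dominates (P : profile S) (x y : assignment) : Prop :=
  forall i a b, x i a = 1 -> y i b = 1 -> weakly_prefers (P i) a b.

Definition strictly_ex_post_dominates (P : profile S) (x y : assignment) :
    Prop :=
  ex_post_dominates P x y /\
  exists i a b, [/\ x i a = 1, y i b = 1 & prefers (P i) a b].

Definition det_ex_post_efficient (P : profile S) (x : assignment) : Prop :=
  deterministic x /\
  forall y, deterministic y -> ~ strictly_ex_post_dominates P y x.

Definition ex_post_efficient (P : profile S) (x : assignment) : Prop :=
  exists (K : nat) (w : 'I_K -> R) (y : 'I_K -> assignment),
    [/\ forall l, 0 <= w l,
        \sum_l w l = 1,
        forall l, det_ex_post_efficient P (y l)
      & forall i j, x i j = \sum_l w l * y l i j].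

Definition fosd (P : pref M) (v w : {ffun M -> R}) : Prop :=
  forall k : 'I_#|M|,
    \sum_(j | prefers P j (choice_at P k)) v j >=
    \sum_(j | prefers P j (choice_at P k)) w j.

Definition ordinally_dominates (P : profile S) (x y : assignment) : Prop :=
  forall i, fosd (P i) (x i) (y i).

Definition rank_distr (P : profile S) (x : assignment) (k : 'I_#|M|) : R :=
  \sum_(i : N) x i (choice_at (P i) k).

Definition rank_dominates (P : profile S) (x y : assignment) : Prop :=
  forall r : 'I_#|M|,
    \sum_(k < #|M| | (k <= r)%N) (rank_distr P x k - rank_distr P y k) >= 0.

End Assignments.

(* Main.v *)
Require Import Defs.
From mathcomp Require Import all_boot all_order all_algebra.
From mathcomp Require Import lra.
Set Implicit Arguments.
Unset Strict Implicit.
Unset Printing Implicit Defensive.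
Import Order.TTheory GRing.Theory Num.Theory.
Local Open Scope ring_scope.

(* Ordinal and rank dominance compare values of linear functionals of the
   assignment, and the value at the hybrid is the corresponding convex
   combination, which lies between its endpoints exactly when they are ordered.
   For ex-post efficiency, the two lotteries are run with probabilities 1 - beta
   and beta. *)

Lemma le_conv (R : realFieldType) (b s t : R) : 0 <= b <= 1 ->
  (s <= t) = (s <= (1 - b) * s + b * t) && ((1 - b) * s + b * t <= t).
Proof.
move=> /andP[b0 b1]; apply/idP/andP => [le_st|[]]; last exact: le_trans.
(* The two gaps are [b * (t - s)] and [(1 - b) * (t - s)], products of nonnegative factors. *)
by split; nra.
Qed.

Section Hybrid.
Variables (R : realFieldType) (S : setting) (P : profile S).
Implicit Types (b : R) (x y : assignment R S).

Lemma ex_post_efficient_conv b (hb : 0 <= b <= 1) x y :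
  ex_post_efficient P x -> ex_post_efficient P y ->
  ex_post_efficient P (Assignment (conv_is_assignment x y hb)).
Proof.
move=> [K [v [u [v0 v1 u_eff xE]]]] [L [w [z [w0 w1 z_eff yE]]]].
have /andP[b0 b1] := hb.
(* The compound lottery: the first [K] indices carry the lottery of [x] scaled by [1 - b], the last
   [L] that of [y] scaled by [b]. *)
exists (K + L)%N,
  (fun l => match split l with inl k => (1 - b) * v k | inr k => b * w k end),
  (fun l => match split l with inl k => u k | inr k => z k end).
split=> [l||l|i j].
- by case: split => k; rewrite mulr_ge0 ?subr_ge0.
- rewrite big_split_ord /=.
  (* [lshift] and [rshift] are [unsplit] of [inl] and [inr] up to conversion, so [unsplitK] resolves
     the [match]. *)
  under eq_bigr do rewrite (unsplitK (inl _)).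
  under [X in _ + X]eq_bigr do rewrite (unsplitK (inr _)).
  by rewrite -!mulr_sumr v1 w1 !mulr1 subrK.
- by case: split.
- rewrite big_split_ord /= !ffunE xE yE.
  under [in RHS]eq_bigr do rewrite (unsplitK (inl _)) -mulrA.
  under [X in _ = _ + X]eq_bigr do rewrite (unsplitK (inr _)) -mulrA.
  by rewrite -!mulr_sumr.
Qed.

(** Linearity for the functionals in [fosd], where [A] is the set of objects preferred to a given
    choice. *)
Lemma sum_conv_mx b x y i (A : pred (object S)) :
  \sum_(j | A j) conv_mx b x y i j =
  (1 - b) * (\sum_(j | A j) x i j) + b * (\sum_(j | A j) y i j).
Proof.
by under eq_bigr do rewrite !ffunE; rewrite big_split -!mulr_sumr.
Qed.

Lemma ordinally_dominates_conv b (hb : 0 <= b <= 1) x y :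
  let z := Assignment (conv_is_assignment x y hb) in
  ordinally_dominates P y x <->
  ordinally_dominates P z x /\ ordinally_dominates P y z.
Proof.
split=> [yx|[zx yz] i k]; last exact: le_trans (zx i k) (yz i k).
(* The two conjuncts given by [le_conv] are the two required dominances at [i] and [k]. *)
by split=> i k; have := yx i k;
  rewrite (le_conv _ _ hb) -sum_conv_mx => /andP[].
Qed.

Lemma rank_distr_conv b (hb : 0 <= b <= 1) x y k :
  rank_distr P (Assignment (conv_is_assignment x y hb)) k =
  (1 - b) * rank_distr P x k + b * rank_distr P y k.
Proof.
rewrite /rank_distr; under eq_bigr do rewrite !ffunE.
by rewrite big_split -!mulr_sumr.
Qed.

(** Separating the sum of differences into two cumulative sums gives the form [s <= t] to which
    [le_conv] applies. *)
Lemma rank_dominatesE x y :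
  rank_dominates P x y <-> forall r : 'I_#|object S|,
    \sum_(k < #|object S| | (k <= r)%N) rank_distr P y k <=
    \sum_(k < #|object S| | (k <= r)%N) rank_distr P x k.
Proof. by split=> xy r; have := xy r; rewrite sumrB subr_ge0. Qed.

Lemma rank_dominates_conv b (hb : 0 <= b <= 1) x y :
  let z := Assignment (conv_is_assignment x y hb) in
  rank_dominates P y x <-> rank_dominates P z x /\ rank_dominates P y z.
Proof.
move=> z; rewrite !rank_dominatesE.
split=> [yx|[zx yz] r]; last exact: le_trans (zx r) (yz r).
(* Cumulative rank sums are linear in the assignment because each [rank_distr] entry is. *)
have zE (r : 'I_#|object S|) :
    \sum_(k < #|object S| | (k <= r)%N) rank_distr P z k =
    (1 - b) * (\sum_(k < #|object S| | (k <= r)%N) rank_distr P x k) +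
    b * (\sum_(k < #|object S| | (k <= r)%N) rank_distr P y k).
  under eq_bigr do rewrite rank_distr_conv.
  by rewrite big_split -!mulr_sumr.
by split=> r; have := yx r; rewrite (le_conv _ _ hb) -zE => /andP[].
Qed.

End Hybrid.

Theorem theorem2 (R : realFieldType) (S : setting) (phi psi : mechanism R S)
    (P : profile S) (beta : R) (hbeta : 0 <= beta <= 1) :
  let h := hybrid hbeta phi psi in
  [/\ ex_post_efficient P (phi P) -> ex_post_efficient P (psi P) ->
        ex_post_efficient P (h P),
      ordinally_dominates P (psi P) (phi P) <->
        ordinally_dominates P (h P) (phi P) /\
        ordinally_dominates P (psi P) (h P)
    & rank_dominates P (psi P) (phi P) <->
        rank_dominates P (h P) (phi P) /\
        rank_dominates P (psi P) (h P)].
Proof.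
split.
- exact: ex_post_efficient_conv.
- exact: ordinally_dominates_conv.
- exact: rank_dominates_conv.
Qed.
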